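(* Consider a Markov jump positive semilinear problem satisfying the Markov jump versions of Closure and Attainability, Stabilizability, State Space Structure, Observability, and the Cartesian Product Condition, and its deterministic equivalent problem with state space $\overline X$, constraint sets $\overline U(\bar x)$, system function $\bar f$, cost per stage $\bar g$, and policy set $\overline{\mathcal M}$ (all as defined in the context). For every policy $\bar\mu\in\overline{\mathcal M}$ that corresponds to a policy $\mu\in\widehat{\mathcal M}$ via $\bar\mu(\bar x)=(\mu(x^1,1),\dots,\mu(x^r,r))$, $$\bar f(\bar x,\bar\mu(\bar x))=\bar A_\mu\bar x,\qquad \bar g(\bar x,\bar\mu(\bar x))=\bar q_\mu'\bar x,\qquad\text{for all }\bar x\in\overline X.$$ Moreover, the deterministic equivalent problem satisfies the following: (a) For every $c\in\mathbb R^{rn}_+$, the function $\bar x\mapsto\min_{\bar u\in\overline U(\bar x)}[\bar g(\bar x,\bar u)+\alpha c'\bar f(\bar x,\bar u)]$ belongs to $\overline{\mathcal J}$, i.e., it has the form $\hat c'\bar x$ for some unique $\hat c\in\mathbb R^{rn}_+$; $\hat c$ depends continuously on $c$; and there is a policy $\bar\mu\in\overline{\mathcal M}$ such that $\bar\mu(\bar x)\in\arg\min_{\bar u\in\overline U(\bar x)}[\bar g(\bar x,\bar u)+\alpha c'\bar f(\bar x,\bar u)]$ for all $\bar x\in\overline X$. (b) There exists a policy in $\overline{\mathcal M}$, corresponding to some $\hat\mu\in\widehat{\mathcal M}$, such that $\alpha\bar A_{\hat\mu}$ is stable. (c) For every $v\in\mathbb R^{rn}_+$ there exist $\bar x\in\overline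 X$ and a scalar $s\ge0$ such that $s\bar x=v$. (d) There exists an integer $N$ such that the optimal cost of the $N$-stage version of the problem (minimizing $\sum_{k=0}^{N-1}\alpha^k\bar g(\bar x_k,\bar u_k)$, starting from any nonzero initial state $\bar x_0\in\overline X$) is strictly positive.
   Context: Notation: $\mathbb R^n_+$ is the set of vectors in $\mathbb R^n$ with nonnegative components; a prime denotes transposition. A square matrix is stable if all its eigenvalues lie strictly within the unit circle. Markov jump positive semilinear problem: $X\subset\mathbb R^n_+$; the parameter $\theta$ takes values in $\Theta=\{1,\dots,r\}$ and evolves as a Markov chain with transition probabilities $p_{ij}=P(\theta_{k+1}=j\mid\theta_k=i)$. The augmented state is $(x_k,\theta_k)\in X\times\Theta$, known when the control is chosen. $U(x,\theta)$ are nonempty control constraint sets; $\alpha\in(0,1]$. For each $(x_0,\theta_0)\in X\times\Theta$ the problem is to minimize $\lim_{N\to\infty}E\{\sum_{k=0}^{N-1}\alpha^kg(x_k,\theta_k,\mu_k(x_k,\theta_k),w_k)\}$ over sequences $\{\mu_k\}$ with $\mu_k(x,\theta)\in U(x,\theta)$, subject to $x_{k+1}=f(x_k,\theta_k,\mu_k(x_k,\theta_k),w_k)$, $\theta_{k+1}=w_k$, where $w_k\in\Theta$ has distribution $P(w_k=j\mid\theta_k=i)=p_{ij}$. $E_w\{\cdot\mid\theta\}$ denotes expectation over $w$ with $P(w=j)=p_{\theta j}$. For all $x\in X$, $\theta,w\in\Theta$, $u\in U(x,\theta)$: $f(x,\theta,u,w)\in X$, $E_w\{f(x,\theta,u,w)\mid\theta\}\in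 X$, $g(x,\theta,u,w)\ge0$. A (stationary) policy is a function $\mu$ on $X\times\Theta$ with $\mu(x,\theta)\in U(x,\theta)$. $\widehat{\mathcal M}$ is a given set of policies such that for every $\mu\in\widehat{\mathcal M}$, $\theta,w\in\Theta$ there exist an $n\times n$ nonnegative matrix $A_\mu^{\theta w}$ and a nonnegative vector $q_\mu^{\theta w}\in\mathbb R^n$ with $f(x,\theta,\mu(x,\theta),w)=A_\mu^{\theta w}x$ and $g(x,\theta,\mu(x,\theta),w)=(q_\mu^{\theta w})'x$ for all $x\in X$. $\mathcal C$ is the set of $r$-tuples $c=(c(1),\dots,c(r))$ with $c(\theta)\in\mathbb R^n_+$ (identified with $\mathbb R^{rn}_+$), and $\widehat{\mathcal J}$ is the set of functions $J(x,\theta)=c(\theta)'x$ with $c\in\mathcal C$. For $\mu\in\widehat{\mathcal M}$, $\bar A_\mu$ is the $rn\times rn$ matrix whose $(i,j)$ block of size $n\times n$ is $p_{ji}A_\mu^{ji}$, $i,j=1,\dots,r$, and $\bar q_\mu\in\mathbb R^{rn}$ is the vector whose $\theta$-th block is $E_w\{q_\mu^{\theta w}\mid\theta\}$, $\theta=1,\dots,r$. Assumptions (Markov jump versions): Closure and Attainability: for every $c\in\mathcal C$, the function $(x,\theta)\mapsto\min_{u\in U(x,\theta)}E_w\{g(x,\theta,u,w)+\alpha c(w)'f(x,\theta,u,w)\mid\theta\}$ belongs to $\widehat{\mathcal J}$, i.e., equals $\hat c(\theta)'x$ for some unique $\hat c\in\mathcal C$; $\hat c$ depends continuously on $c$; and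 for every $\theta\in\Theta$ there is a policy $\mu\in\widehat{\mathcal M}$ such that $\mu(x,\theta)$ attains this minimum for all $x\in X$. Stabilizability: there exists $\hat\mu\in\widehat{\mathcal M}$ such that $\alpha\bar A_{\hat\mu}$ is stable. State Space Structure: for some scalar $s>0$, every $x\in\mathbb R^n_+$ with $\sum_{i=1}^nx^i\le s$ belongs to $X$ (here $x^i$ is the $i$th component of $x$). Observability: there exists an integer $N$ such that the optimal cost of the $N$-stage problem of minimizing $E\{\sum_{k=0}^{N-1}\alpha^kg(x_k,\theta_k,u_k,w_k)\}$, starting from any nonzero $x_0\in X$ and any $\theta_0\in\Theta$, is strictly positive. Cartesian Product Condition: for every $\mu^1,\dots,\mu^r\in\widehat{\mathcal M}$, the policy that applies $\mu^\theta(x,\theta)$ at each $(x,\theta)$ belongs to $\widehat{\mathcal M}$. Deterministic equivalent problem: the states are the elements of $\overline X=\{\bar x=(x^1,\dots,x^r): x^i\in X,\ i=1,\dots,r\}$; the control constraint set at $\bar x$ is $\overline U(\bar x)=\prod_{\theta=1}^rU(x^\theta,\theta)$, with elements $\bar u=(u^1,\dots,u^r)$; the system is $\bar x_{k+1}=\bar f(\bar x_k,\bar u_k)$ with $\bar f=(\bar f^1,\dots,\bar f^r)$, $\bar f^\theta(\bar x,\bar u)=\sum_{i=1}^rp_{i\theta}f(x^i,i,u^i,\theta)$; the cost per stage is $\bar g(\bar x,\bar u)=\sum_{\theta=1}^rE_w\{g(x^\theta,\theta,u^\theta,w)\mid\theta\}$. For every $\bar x_0\in\overline X$ the problem is to minimize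 $\sum_{k=0}^\infty\alpha^k\bar g(\bar x_k,\bar u_k)$ over $\{\bar u_k\}$ subject to $\bar x_{k+1}=\bar f(\bar x_k,\bar u_k)$, $\bar u_k\in\overline U(\bar x_k)$, $k=0,1,\dots$. $\overline{\mathcal M}$ is the set of policies $\bar\mu(\bar x)=(\mu(x^1,1),\dots,\mu(x^r,r))$ with $\mu\in\widehat{\mathcal M}$, and $\overline{\mathcal J}$ is the set of functions $\overline J(\bar x)=c'\bar x$ with $c=(c(1),\dots,c(r))$, $c(i)\in\mathbb R^n_+$. *)

(* Defs.v *)
From HB Require Import structures.
From mathcomp Require Import all_boot all_order all_algebra.
From mathcomp Require Import complex.
From mathcomp Require Import all_classical all_reals all_analysis.

Set Implicit Arguments.
Unset Strict Implicit.
Unset Printing Implicit Defensive.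

Import Order.TTheory GRing.Theory Num.Theory.
Import numFieldNormedType.Exports.

Local Open Scope classical_set_scope.
Local Open Scope ring_scope.

Definition nonneg (R : realType) (m k : nat) : set 'M[R]_(m, k) :=
  [set B | forall i j, 0 <= B i j].

Definition dot (R : realType) (m : nat) (c x : 'cV[R]_m) : R :=
  (c^T *m x) 0 0.

(* Eigenvalues are the complex ones, whence the embedding of R into R[i]. *)
Definition stable (R : realType) (m : nat) (B : 'M[R]_m) : Prop :=
  forall z : complex R,
    eigenvalue (map_mx (real_complex R) B) z -> `|z| < 1.

Definition argmin (R : realType) (T : Type) (S : set T) (F : T -> R) : set T :=
  [set u | S u /\ forall v, S v -> F u <= F v].

Definition is_min (R : realType) (T : Type) (S : set T) (F : T -> R) (m : R) :
    Prop :=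
  exists2 u, argmin S F u & F u = m.

Section Problem.
Context {R : realType} {n r : nat}.

(* An r-tuple of vectors of R^n is stored as the stacked vector of R^(rn);
   [blk v th] is its th-th component. *)
Definition stacked := 'cV[R]_(\sum_(i < r) n).

Definition blk (v : stacked) (th : 'I_r) : 'cV[R]_n :=
  @submxcol R r (fun=> n) 1 v th.

(* The mode set is 'I_r.  Constraint sets, system function, cost and policies
   are total functions, constrained (and used) only at states of X; thus
   [Mhat] stands for the policies whose restriction to X * Theta is in the
   given set.  Nonnegative matrices [A mu th w] and vectors [q mu th w]
   witnessing the linearity under the policies of [Mhat] are part of
   the data. *)
Record mj_problem := MJProblem {
  ctrl : Type;
  X : set 'cV[R]_n;
  p : 'I_r -> 'I_r -> R;
  U : 'cV[R]_n -> 'I_r -> set ctrl;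
  f : 'cV[R]_n -> 'I_r -> ctrl -> 'I_r -> 'cV[R]_n;
  g : 'cV[R]_n -> 'I_r -> ctrl -> 'I_r -> R;
  alpha : R;
  Mhat : set ('cV[R]_n -> 'I_r -> ctrl);
  A : ('cV[R]_n -> 'I_r -> ctrl) -> 'I_r -> 'I_r -> 'M[R]_n;
  q : ('cV[R]_n -> 'I_r -> ctrl) -> 'I_r -> 'I_r -> 'cV[R]_n;
  X_nonneg : X `<=` @nonneg R n 1;
  p_ge0 : forall i j, 0 <= p i j;
  p_sum1 : forall i, \sum_j p i j = 1;
  U_nonempty : forall x th, X x -> U x th !=set0;
  alpha_gt0 : 0 < alpha;
  alpha_le1 : alpha <= 1;
  f_X : forall x th u w, X x -> U x th u -> X (f x th u w);
  Ef_X : forall x th u, X x -> U x th u -> X (\sum_w p th w *: f x th u w);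
  g_ge0 : forall x th u w, X x -> U x th u -> 0 <= g x th u w;
  Mhat_policy : forall mu x th, Mhat mu -> X x -> U x th (mu x th);
  A_nonneg : forall mu th w, Mhat mu -> nonneg (A mu th w);
  q_nonneg : forall mu th w, Mhat mu -> nonneg (q mu th w);
  f_linear : forall mu x th w, Mhat mu -> X x ->
    f x th (mu x th) w = A mu th w *m x;
  g_linear : forall mu x th w, Mhat mu -> X x ->
    g x th (mu x th) w = dot (q mu th w) x }.

End Problem.

Arguments stacked R n r : clear implicits.
Arguments mj_problem R n r : clear implicits.
Arguments U {R n r} m x th : rename.
Arguments f {R n r} m x th u w : rename.
Arguments g {R n r} m x th u w : rename.
Arguments Mhat {R n r} m : rename.
Arguments A {R n r} m mu th w : rename.
Arguments q {R n r} m mu th w : rename.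

Unset Implicit Arguments.

Section Theory.
Context {R : realType} {n r : nat}.
Variable P : mj_problem R n r.

Local Notation stacked := (stacked R n r).

Definition policy := 'cV[R]_n -> 'I_r -> ctrl P.

Definition Abar (mu : policy) : 'M[R]_(\sum_(i < r) n) :=
  \mxblock_(i < r, j < r) (p P j i *: A P mu j i).

Definition qbar (mu : policy) : stacked :=
  \mxcol_(th < r) \sum_w p P th w *: q P mu th w.

Definition bellman_cost (c : stacked) (x : 'cV[R]_n) (th : 'I_r)
    (u : ctrl P) : R :=
  \sum_w p P th w * (g P x th u w + alpha P * dot (blk c w) (f P x th u w)).

Definition bellman_repr (c ch : stacked) : Prop :=
  nonneg ch /\
  forall x th, X P x -> is_min (U P x th) (bellman_cost c x th) (dot (blk ch th) x).

Definition closure_attainability : Prop :=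
  exists G : stacked -> stacked,
  [/\ forall c, nonneg c ->
        bellman_repr c (G c) /\ forall ch, bellman_repr c ch -> ch = G c,
      {within @nonneg R _ 1, continuous G} &
      forall c th, nonneg c -> exists2 mu, Mhat P mu &
        forall x, X P x -> argmin (U P x th) (bellman_cost c x th) (mu x th)].

Definition stabilizability : Prop :=
  exists2 mu, Mhat P mu & stable (alpha P *: Abar mu).

Definition state_space_structure : Prop :=
  exists2 s : R, 0 < s &
    forall x : 'cV[R]_n, nonneg x -> \sum_i x i 0 <= s -> X P x.

Definition cartesian_product_condition : Prop :=
  forall mus : 'I_r -> policy, (forall th, Mhat P (mus th)) ->
    Mhat P (fun x th => mus th x th).

(* [modes k] is theta_k, so that w_k is [modes k.+1]. *)
Fixpoint mj_state (pi : nat -> policy) (modes : nat -> 'I_r) (x0 : 'cV[R]_n)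
    (k : nat) : 'cV[R]_n :=
  if k is k'.+1 then
    let x := mj_state pi modes x0 k' in
    f P x (modes k') (pi k' x (modes k')) (modes k'.+1)
  else x0.

Definition mj_path_cost (N : nat) (pi : nat -> policy) (modes : nat -> 'I_r)
    (x0 : 'cV[R]_n) : R :=
  \sum_(k < N) alpha P ^+ k *
    (let x := mj_state pi modes x0 k in
     g P x (modes k) (pi k x (modes k)) (modes k.+1)).

(* Expectation over the law of (w_0, ..., w_{N-1}) given theta_0 = th0, which
   gives mass \prod_k p theta_k w_k to each N-tuple w. *)
Definition mj_cost (N : nat) (pi : nat -> policy) (x0 : 'cV[R]_n)
    (th0 : 'I_r) : R :=
  \sum_(w : N.-tuple 'I_r)
    let modes := nth th0 (th0 :: w) in
    (\prod_(k < N) p P (modes k) (modes k.+1)) * mj_path_cost N pi modes x0.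

Definition mj_admissible : set (nat -> policy) :=
  [set pi | forall k x th, X P x -> U P x th (pi k x th)].

Definition mj_opt_cost (N : nat) (x0 : 'cV[R]_n) (th0 : 'I_r) : \bar R :=
  ereal_inf [set (mj_cost N pi x0 th0)%:E | pi in mj_admissible].

Definition observability : Prop :=
  exists N : nat, forall x0 th0, X P x0 -> x0 != 0 ->
    (0 < mj_opt_cost N x0 th0)%E.

Definition Xbar : set stacked := [set xb | forall th, X P (blk xb th)].

Definition Ubar (xb : stacked) : set ('I_r -> ctrl P) :=
  [set ub | forall th, U P (blk xb th) th (ub th)].

Definition fbar (xb : stacked) (ub : 'I_r -> ctrl P) : stacked :=
  \mxcol_(th < r) \sum_i p P i th *: f P (blk xb i) i (ub i) th.

Definition gbar (xb : stacked) (ub : 'I_r -> ctrl P) : R :=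
  \sum_th \sum_w p P th w * g P (blk xb th) th (ub th) w.

Definition bar_policy (mu : policy) : stacked -> 'I_r -> ctrl P :=
  fun xb th => mu (blk xb th) th.

Definition Mbar : set (stacked -> 'I_r -> ctrl P) :=
  [set bar_policy mu | mu in Mhat P].

Definition det_bellman_cost (c xb : stacked) (ub : 'I_r -> ctrl P) : R :=
  gbar xb ub + alpha P * dot c (fbar xb ub).

Definition det_bellman_repr (c ch : stacked) : Prop :=
  nonneg ch /\
  forall xb, Xbar xb -> is_min (Ubar xb) (det_bellman_cost c xb) (dot ch xb).

Fixpoint det_state (x0 : stacked) (ub : nat -> 'I_r -> ctrl P) (k : nat) :
    stacked :=
  if k is k'.+1 then fbar (det_state x0 ub k') (ub k') else x0.

(* [fbar xb ub] need not lie in [Xbar], as the weights p i th (i : 'I_r) of its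
   th-th block are not probabilities; so membership of the states in [Xbar] is
   an explicit constraint at every stage where a control is chosen. *)
Definition det_admissible (N : nat) (x0 : stacked) :
    set (nat -> 'I_r -> ctrl P) :=
  [set ub | forall k, (k < N)%N ->
     Xbar (det_state x0 ub k) /\ Ubar (det_state x0 ub k) (ub k)].

Definition det_cost (N : nat) (x0 : stacked) (ub : nat -> 'I_r -> ctrl P) : R :=
  \sum_(k < N) alpha P ^+ k * gbar (det_state x0 ub k) (ub k).

Definition det_opt_cost (N : nat) (x0 : stacked) : \bar R :=
  ereal_inf [set (det_cost N x0 ub)%:E | ub in det_admissible N x0].

End Theory.

(* Main.v *)
(* The deterministic Bellman cost at xb = (x^1, ..., x^r) is the sum over th of
   the Markov jump Bellman costs at (x^th, th), and the control components can
   be chosen independently; hence both problems have the same Bellman operator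
   G on cost vectors.  For observability, every N-stage cost of the
   deterministic problem is at least (G^N 0)' xb, while in the jump problem
   the cost (G^N 0)(th)' x is attained from (x, th) by a policy greedy for the
   value iterates, so that it is positive for x nonzero. *)
Require Import Defs.
From mathcomp Require Import all_boot all_order all_algebra.
From mathcomp Require Import all_classical all_reals all_analysis.

Import Order.TTheory GRing.Theory Num.Theory.
Import numFieldNormedType.Exports.

Local Open Scope classical_set_scope.
Local Open Scope ring_scope.

Set Implicit Arguments.
Unset Strict Implicit.
Unset Printing Implicit Defensive.

(** * Bilinearity and positivity of the inner product, uniqueness of minima *)

Lemma dot_sumr (R : realType) (m : nat) (I : finType) (c : 'cV[R]_m)
    (F : I -> 'cV[R]_m) : dot c (\sum_i F i) = \sum_i dot c (F i).
Proof. by rewrite /dot mulmx_sumr summxE. Qed.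

Lemma dot_suml (R : realType) (m : nat) (I : finType) (x : 'cV[R]_m)
    (F : I -> 'cV[R]_m) : dot (\sum_i F i) x = \sum_i dot (F i) x.
Proof. by rewrite /dot raddf_sum mulmx_suml summxE. Qed.

Lemma dotZr (R : realType) (m : nat) (a : R) (c x : 'cV[R]_m) :
  dot c (a *: x) = a * dot c x.
Proof. by rewrite /dot -scalemxAr mxE. Qed.

Lemma dotZl (R : realType) (m : nat) (a : R) (c x : 'cV[R]_m) :
  dot (a *: c) x = a * dot c x.
Proof. by rewrite /dot linearZ /= -scalemxAl mxE. Qed.

Lemma dot0l (R : realType) (m : nat) (x : 'cV[R]_m) : dot 0 x = 0.
Proof. by rewrite /dot trmx0 mul0mx mxE. Qed.

Lemma dot_delta (R : realType) (m : nat) (c : 'cV[R]_m) (i : 'I_m) :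
  dot c (delta_mx i 0) = c i 0.
Proof. by rewrite /dot -colE !mxE. Qed.

Lemma dot_ge0 (R : realType) (m : nat) (c x : 'cV[R]_m) :
  nonneg c -> nonneg x -> 0 <= dot c x.
Proof.
move=> c0 x0; rewrite /dot mxE; apply: sumr_ge0 => i _.
by rewrite mxE mulr_ge0.
Qed.

Lemma is_min_inj (R : realType) (T : Type) (S : set T) (F : T -> R) (a b : R) :
  is_min S F a -> is_min S F b -> a = b.
Proof.
move=> [u [Su uP] <-] [v [Sv vP] <-].
by apply/eqP; rewrite eq_le uP ?vP.
Qed.

(** * Block decomposition of stacked vectors *)

Section Stacked.
Context {R : realType} {n r : nat}.
Implicit Types v c : stacked R n r.

Lemma blk_mxcol (F : 'I_r -> 'cV[R]_n) th : blk (\mxcol_i F i) th = F th.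
Proof. exact: mxcolK. Qed.

Lemma mxcol_blk v : v = \mxcol_th blk v th.
Proof. by rewrite submxcolK. Qed.

Lemma blk0 th : blk (0 : stacked R n r) th = 0.
Proof. by apply/matrixP => i j; rewrite !mxE. Qed.

Lemma blkZ (a : R) v th : blk (a *: v) th = a *: blk v th.
Proof. by apply/matrixP => i j; rewrite !mxE. Qed.

Lemma blk_nonneg v th : nonneg v -> nonneg (blk v th).
Proof. by move=> v0 i j; rewrite mxE. Qed.

Lemma dot_blk c v : dot c v = \sum_th dot (blk c th) (blk v th).
Proof.
rewrite {1}(mxcol_blk c) {1}(mxcol_blk v) /dot tr_mxcol mul_mxrow_mxcol.
by rewrite summxE.
Qed.

Lemma stacked_neq0 v : v != 0 -> exists th, blk v th != 0.
Proof.
move=> v0; apply: contrapT => H; move/eqP: v0; apply.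
rewrite (mxcol_blk v) -mxcol0; apply: eq_mxcol => th.
by apply/eqP/negP => /negP ne; apply: H; exists th.
Qed.

End Stacked.

(** Head and tail give a bijection between tuples and pairs. Applied to mode sequences, this
    conditions an expectation on the first transition. *)
Lemma big_tuple_cons (R : realType) (T : finType) (N : nat)
    (F : N.+1.-tuple T -> R) :
  \sum_w F w = \sum_x \sum_(t : N.-tuple T) F [tuple of x :: t].
Proof.
rewrite pair_big /=.
rewrite (reindex (fun xt : T * N.-tuple T => [tuple of xt.1 :: xt.2])) //=.
exists (fun w => (thead w, [tuple of behead w])) => [[x t] _|w _] /=.
  by congr pair; apply: val_inj.
by rewrite [RHS]tuple_eta.
Qed.

(** * Dynamic programming recursion for the finite-horizon jump cost *)

Section MarkovCost.
Context {R : realType} {n r : nat} (P : mj_problem R n r).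
Implicit Types (pi : nat -> policy P) (modes : nat -> 'I_r).

Lemma mj_state_eq pi m1 m2 x N k : (forall i, (i <= N)%N -> m1 i = m2 i) ->
  (k <= N)%N -> mj_state P pi m1 x k = mj_state P pi m2 x k.
Proof.
by move=> e; elim: k => //= k IH kN; rewrite IH 1?ltnW // !e // ltnW.
Qed.

(** Permits a change of the default element of [nth] in a mode sequence, since such defaults show up
    only beyond the horizon. *)
Lemma mj_path_cost_eq pi m1 m2 x N : (forall i, (i <= N)%N -> m1 i = m2 i) ->
  mj_path_cost P N pi m1 x = mj_path_cost P N pi m2 x.
Proof.
move=> e; apply: eq_bigr => k _ /=; have kN := ltn_ord k.
by rewrite (mj_state_eq _ _ e (ltnW kN)) !e // ltnW.
Qed.

Lemma mj_stateS pi modes x k :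
  mj_state P pi modes x k.+1 =
  mj_state P (fun k => pi k.+1) (fun k => modes k.+1)
    (f P x (modes 0%N) (pi 0%N x (modes 0%N)) (modes 1%N)) k.
Proof. by elim: k => //= k <-. Qed.

Lemma mj_path_costS pi modes x N :
  mj_path_cost P N.+1 pi modes x =
  g P x (modes 0%N) (pi 0%N x (modes 0%N)) (modes 1%N) +
  alpha P * mj_path_cost P N (fun k => pi k.+1) (fun k => modes k.+1)
    (f P x (modes 0%N) (pi 0%N x (modes 0%N)) (modes 1%N)).
Proof.
rewrite /mj_path_cost big_ord_recl /= expr0 mul1r; congr (_ + _).
rewrite mulr_sumr; apply: eq_bigr => k _.
by rewrite -mj_stateS mulrA -exprS.
Qed.

Definition path_prob (th : 'I_r) (N : nat) (w : seq 'I_r) : R :=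
  \prod_(k < N) p P (nth th (th :: w) k) (nth th (th :: w) k.+1).

(* The default element of [nth] changes with the initial mode, harmlessly:
   only indices within bounds occur. *)
Lemma nth_shift (th w0 : 'I_r) N (t : N.-tuple 'I_r) i : (i <= N)%N ->
  nth th (w0 :: t) i = nth w0 (w0 :: t) i.
Proof. by move=> iN; apply: set_nth_default; rewrite /= size_tuple ltnS. Qed.

Lemma path_probS th w0 N (t : N.-tuple 'I_r) :
  path_prob th N.+1 (w0 :: t) = p P th w0 * path_prob w0 N t.
Proof.
rewrite /path_prob big_ord_recl /=; congr (_ * _); apply: eq_bigr => k _.
have kN := ltnW (ltn_ord k).
by rewrite -[nth w0 t k]/(nth w0 (w0 :: t) k.+1) -!(@nth_shift th _ N).
Qed.

Lemma path_prob_sum1 th N : \sum_(w : N.-tuple 'I_r) path_prob th N w = 1.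
Proof.
elim: N th => [|N IH] th.
  rewrite (eq_bigr (fun=> 1)) => [|w _]; last by rewrite /path_prob big_ord0.
  by rewrite sumr_const card_tuple expn0.
rewrite big_tuple_cons -[RHS](p_sum1 P th); apply: eq_bigr => w0 _.
under eq_bigr do rewrite path_probS.
by rewrite -mulr_sumr IH mulr1.
Qed.

Lemma mj_costE N pi x th : mj_cost P N pi x th =
  \sum_(w : N.-tuple 'I_r)
    path_prob th N w * mj_path_cost P N pi (nth th (th :: w)) x.
Proof. by []. Qed.

(** Conditioning on the first transition: the first stage cost does not depend on the later modes,
    whose path probabilities sum to one, so it leaves the inner expectation unchanged. *)
Lemma mj_costS N pi x th :
  mj_cost P N.+1 pi x th =
  \sum_w p P th w * (g P x th (pi 0%N x th) w +
    alpha P * mj_cost P N (fun k => pi k.+1) (f P x th (pi 0%N x th) w) w).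
Proof.
rewrite mj_costE big_tuple_cons; apply: eq_bigr => w0 _.
under eq_bigr => t _.
  rewrite path_probS mj_path_costS /= -mulrA.
  rewrite (@mj_path_cost_eq _ _ (nth w0 (w0 :: t)) _ N); last first.
    by move=> i; apply: nth_shift.
  over.
rewrite -mulr_sumr; congr (_ * _).
under eq_bigr do rewrite mulrDr mulrCA.
by rewrite big_split /= -mulr_suml path_prob_sum1 mul1r -mulr_sumr.
Qed.

End MarkovCost.

(** * Linear policies, Bellman operator and state space of the deterministic problem *)

Section DeterministicEquivalent.
Context {R : realType} {n r : nat} (P : mj_problem R n r).
Implicit Types c xb : stacked R n r.

(** The weights [p i th] of [fbar] are summed over the source mode [i], which matches the transposed
    indices in the blocks of [Abar]; the rest is block multiplication. *)
Lemma fbar_bar_policy mu xb : Mhat P mu -> Xbar P xb ->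
  fbar P xb (bar_policy P mu xb) = Abar P mu *m xb.
Proof.
move=> Mmu Xxb; rewrite [in RHS](mxcol_blk xb) /Abar mul_mxblock_mxrow.
apply: eq_mxcol => th; apply: eq_bigr => i _.
by rewrite f_linear // -scalemxAl.
Qed.

Lemma gbar_bar_policy mu xb : Mhat P mu -> Xbar P xb ->
  gbar P xb (bar_policy P mu xb) = dot (qbar P mu) xb.
Proof.
move=> Mmu Xxb; rewrite dot_blk; apply: eq_bigr => th _.
rewrite blk_mxcol dot_suml; apply: eq_bigr => w _.
by rewrite dotZl g_linear.
Qed.

(** [fbar] gathers, for each next mode, contributions from all source modes. Exchanging the two sums
    groups them by source mode, where they form the expectation over [w] of the jump problem. *)
Lemma det_bellman_costE c xb ub :
  det_bellman_cost P c xb ub =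
  \sum_th bellman_cost P c (blk xb th) th (ub th).
Proof.
rewrite /det_bellman_cost /gbar dot_blk.
under [X in alpha P * X]eq_bigr do rewrite blk_mxcol dot_sumr.
rewrite [X in alpha P * X]exchange_big mulr_sumr -big_split /=; apply: eq_bigr => th _.
rewrite mulr_sumr -big_split; apply: eq_bigr => w _ /=.
by rewrite dotZr mulrDr (mulrCA (alpha P)).
Qed.

Lemma argmin_bar c xb ub :
  (forall th,
    argmin (U P (blk xb th) th) (bellman_cost P c (blk xb th) th) (ub th)) ->
  argmin (Ubar P xb) (det_bellman_cost P c xb) ub.
Proof.
move=> H; split=> [th|vb Uvb]; first by case: (H th).
rewrite !det_bellman_costE; apply: ler_sum => th _.
by case: (H th) => _; apply.
Qed.

Lemma bellman_repr_bar c ch :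
  bellman_repr P c ch -> det_bellman_repr P c ch.
Proof.
move=> [ch0 H]; split=> // xb Xxb.
have /choice[ub ubP] th : exists u,
    argmin (U P (blk xb th) th) (bellman_cost P c (blk xb th) th) u /\
    bellman_cost P c (blk xb th) th u = dot (blk ch th) (blk xb th).
  by have [u] := H _ th (Xxb th); exists u.
exists ub; first by apply: argmin_bar => th; case: (ubP th).
by rewrite det_bellman_costE dot_blk; apply: eq_bigr => th _; case: (ubP th).
Qed.

Lemma Xbar_cone : state_space_structure P ->
  forall v : stacked R n r, nonneg v ->
  exists xb s, [/\ Xbar P xb, 0 <= s & s *: xb = v].
Proof.
move=> [s s0 sX] v v0.
pose t := \sum_th \sum_i blk v th i 0.
have bv0 th i : 0 <= blk v th i 0 by apply: blk_nonneg.
have t0 : 0 <= t by apply: sumr_ge0 => th _; apply: sumr_ge0.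
(* Every block of [v] has component sum at most [t], and [t <= s * (t / s + 1)], so dividing [v] by
   this factor brings all blocks into [X] at once. The summand 1 keeps the factor positive when
   [v = 0]. *)
have k0 : 0 < t / s + 1 by rewrite ltr_wpDl // divr_ge0 // ltW.
exists ((t / s + 1)^-1 *: v), (t / s + 1); split; last 2 first.
- exact: ltW.
- by rewrite scalerA divff ?scale1r // gt_eqF.
move=> th; rewrite blkZ; apply: sX => [i j|].
  by rewrite mxE mulr_ge0 ?invr_ge0 ?(ltW k0) // (ord1 j).
under eq_bigr do rewrite mxE.
rewrite -mulr_sumr ler_pdivrMl // mulrDl mul1r divfK ?gt_eqF //.
apply: (@le_trans _ _ t); last by rewrite lerDl ltW.
rewrite /t [leRHS](bigD1 th) //= lerDl; apply: sumr_ge0 => i _.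
exact: sumr_ge0.
Qed.

(** Each unit vector is a multiple of a point of [Xbar], so the values on [Xbar] determine every
    coefficient. This yields uniqueness of the Bellman representation. *)
Lemma dot_Xbar_inj c1 c2 : state_space_structure P ->
  (forall xb, Xbar P xb -> dot c1 xb = dot c2 xb) -> c1 = c2.
Proof.
move=> hstate e; apply/matrixP => i j; rewrite (ord1 j) -!dot_delta.
have [|xb [s [Xxb _ <-]]] := Xbar_cone hstate (v := delta_mx i 0).
  by move=> k l; rewrite mxE; case: (_ && _).
by rewrite !dotZr e.
Qed.

Lemma det_bellman_repr_inj c c1 c2 : state_space_structure P ->
  det_bellman_repr P c c1 -> det_bellman_repr P c c2 -> c1 = c2.
Proof.
move=> hstate [_ H1] [_ H2]; apply: dot_Xbar_inj => // xb Xxb.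
exact: is_min_inj (H1 _ Xxb) (H2 _ Xxb).
Qed.

(** * Finite-horizon costs compared with value iterates *)

Lemma det_stateS x ub k :
  det_state P x ub k.+1 = det_state P (fbar P x (ub 0%N)) (fun k => ub k.+1) k.
Proof. by elim: k => //= k <-. Qed.

Lemma det_costS x ub N :
  det_cost P N.+1 x ub =
  gbar P x (ub 0%N) +
  alpha P * det_cost P N (fbar P x (ub 0%N)) (fun k => ub k.+1).
Proof.
rewrite /det_cost big_ord_recl /= expr0 mul1r; congr (_ + _).
rewrite mulr_sumr; apply: eq_bigr => k _.
by rewrite -det_stateS mulrA -exprS.
Qed.

Section ValueIteration.
Variable G : stacked R n r -> stacked R n r.
Hypothesis GP : forall c, nonneg c -> bellman_repr P c (G c).

Lemma iter_nonneg N : nonneg (iter N G 0).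
Proof. by elim: N => [|N /GP[]] //= i j; rewrite mxE. Qed.

(** The minimum defining [G] is at most the Bellman cost of the first control, and induction bounds
    the remaining stages. Since [fbar] may leave [Xbar], membership of each state comes from
    admissibility. *)
Lemma det_cost_ge N x ub : det_admissible P N x ub ->
  dot (iter N G 0) x <= det_cost P N x ub.
Proof.
elim: N x ub => [|N IH] x ub adm.
  by rewrite /det_cost big_ord0 dot0l.
have [Xx Ux] := adm 0%N isT.
have [_ /(_ _ Xx)[vb [_ vbP] /= <-]] :=
  bellman_repr_bar (GP (iter_nonneg N)).
apply: le_trans (vbP _ Ux) _; rewrite det_costS lerD2l.
apply: ler_wpM2l; first exact: ltW (alpha_gt0 P).
by apply: IH => k kN; rewrite -det_stateS; apply: adm.
Qed.

Variable mu : stacked R n r -> policy P.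
Hypothesis muP : forall c, nonneg c -> forall x th, X P x ->
  argmin (U P x th) (bellman_cost P c x th) (mu c x th).

(* With [N - k] stages to go, the policy greedy for the [(N - k - 1)]-th value
   iterate is optimal; truncated subtraction extends it past stage [N]. *)
Lemma mj_cost_greedy N x th : X P x ->
  mj_cost P N (fun k => mu (iter (N.-1 - k) G 0)) x th =
  dot (blk (iter N G 0) th) x.
Proof.
elim: N x th => [|N IH] x th Xx.
  rewrite mj_costE big1 => [|w _]; last by rewrite /mj_path_cost big_ord0 mulr0.
  by rewrite /= blk0 dot0l.
have N0 := iter_nonneg N; have mum := muP N0 th Xx.
have [_ /(_ x th Xx) minP] := GP N0.
rewrite mj_costS /= subn0.
(* The next iterate is the minimal Bellman cost, which the greedy control attains; the two sides can
   thus be compared mode by mode. *)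
rewrite -(is_min_inj (ex_intro2 _ _ _ mum erefl) minP).
apply: eq_bigr => w _; congr (_ * (_ + _ * _)).
rewrite -IH; last by apply: f_X => //; case: mum.
(* Stage [k.+1] with horizon [N.+1] uses the same iterate as stage [k] with horizon [N]. *)
by congr mj_cost; apply/funext => k; rewrite subnS -predn_sub.
Qed.

End ValueIteration.

(** Attainability supplies a separate policy for each mode; the Cartesian product condition glues
    them into one member of [Mhat]. *)
Lemma greedy_policy c : closure_attainability P ->
  cartesian_product_condition P -> nonneg c ->
  exists2 mu, Mhat P mu & forall x th, X P x ->
    argmin (U P x th) (bellman_cost P c x th) (mu x th).
Proof.
move=> [G [_ _ att]] hcart c0.
have /choice[mus musP] th : exists mu, Mhat P mu /\ forall x, X P x ->
    argmin (U P x th) (bellman_cost P c x th) (mu x th).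
  by have [mu] := att c th c0; exists mu.
exists (fun x th => mus th x th); first by apply: hcart => th; case: (musP th).
by move=> x th; case: (musP th) => _; apply.
Qed.

Lemma det_observability : closure_attainability P ->
  cartesian_product_condition P -> observability P ->
  exists N : nat, forall x0, Xbar P x0 -> x0 != 0 ->
    (0 < det_opt_cost P N x0)%E.
Proof.
move=> hclosure hcart [N obs]; exists N => x0 Xx0 x0_neq0.
have [G [GP _ _]] := hclosure.
have {}GP c : nonneg c -> bellman_repr P c (G c) by move=> /GP[].
have [th xth_neq0] := stacked_neq0 x0_neq0.
have /choice[mu muP] c : exists mu : policy P, nonneg c -> Mhat P mu /\
    forall x th, X P x -> argmin (U P x th) (bellman_cost P c x th) (mu x th).
  case: (pselect (nonneg c)) => [c0|nc].
    by have [mu] := greedy_policy hclosure hcart c0; exists mu.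
  (* Filler value making the choice total: outside the nonnegative vectors the requirement is
     vacuous, so a policy greedy for the zero vector serves. *)
  by have [mu] := greedy_policy hclosure hcart (iter_nonneg GP 0); exists mu.
have Nth0 i : nonneg (blk (iter N G 0) i) by apply/blk_nonneg/iter_nonneg.
apply: (@lt_le_trans _ _ (dot (iter N G 0) x0)%:E); last first.
  apply: le_ereal_inf_tmp => _ [ub adm <-]; rewrite lee_fin.
  exact: det_cost_ge.
(* Only one block of [x0] is known to be nonzero; the other blocks contribute nonnegative terms, so
   its term alone bounds the sum from below. *)
apply: (@lt_le_trans _ _ (dot (blk (iter N G 0) th) (blk x0 th))%:E); last first.
  rewrite lee_fin dot_blk [leRHS](bigD1 th) //= lerDl; apply: sumr_ge0 => i _.
  by apply: dot_ge0 => //; apply: (X_nonneg (Xx0 i)).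
(* The greedy policy is admissible, so its cost, here the term of block [th], dominates the positive
   optimal jump cost. *)
apply: lt_le_trans (obs _ _ (Xx0 th) xth_neq0) _; apply: ereal_inf_lbound.
exists (fun k => mu (iter (N.-1 - k) G 0)).
  move=> k x i Xx; apply: Mhat_policy => //.
  exact: (muP _ (iter_nonneg GP (N.-1 - k))).1.
by rewrite (mj_cost_greedy GP) // => c c0; case: (muP _ c0).
Qed.

End DeterministicEquivalent.

Unset Implicit Arguments.
Set Strict Implicit.

Theorem proposition9 (R : realType) (n r : nat) (P : mj_problem R n r)
    (hclosure : closure_attainability P)
    (hstab : stabilizability P)
    (hstate : state_space_structure P)
    (hobs : observability P)
    (hcart : cartesian_product_condition P) :
  (forall (mub : stacked R n r -> 'I_r -> ctrl P) (mu : policy P),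
     Mbar P mub -> Mhat P mu -> mub = bar_policy P mu ->
     forall xb, Xbar P xb ->
       fbar P xb (mub xb) = Abar P mu *m xb /\
       gbar P xb (mub xb) = dot (qbar P mu) xb)
  /\
  (exists G : stacked R n r -> stacked R n r,
   [/\ forall c, nonneg c ->
         det_bellman_repr P c (G c) /\
         (forall ch, det_bellman_repr P c ch -> ch = G c),
       {within @nonneg R _ 1, continuous G} &
       forall c, nonneg c -> exists2 mub, Mbar P mub &
         forall xb, Xbar P xb ->
           argmin (Ubar P xb) (det_bellman_cost P c xb) (mub xb)])
  /\
  (exists2 mub, Mbar P mub &
   exists mu, [/\ Mhat P mu, mub = bar_policy P mu &
     stable (alpha P *: Abar P mu)])
  /\
  (forall v : stacked R n r, nonneg v ->
   exists xb s, [/\ Xbar P xb, 0 <= s & s *: xb = v])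
  /\
  (exists N : nat, forall x0, Xbar P x0 -> x0 != 0 ->
   (0 < det_opt_cost P N x0)%E).
Proof.
have [G [GP Gcont _]] := hclosure.
split=> [mub mu _ Mmu -> xb Xxb|].
  by rewrite fbar_bar_policy ?gbar_bar_policy.
split.
  (* The operator [G] of the jump problem itself serves as witness, so its continuity carries over
     directly. *)
  exists G; split=> // c c0.
    have repr := bellman_repr_bar (GP c c0).1.
    by split=> // ch repr'; apply: det_bellman_repr_inj hstate repr' repr.
  have [mu Mmu muP] := greedy_policy hclosure hcart c0.
  exists (bar_policy P mu); first by exists mu.
  by move=> xb Xxb; apply: argmin_bar => th; apply: muP.
split.
  have [mu Mmu stab] := hstab.
  by exists (bar_policy P mu); [exists mu|exists mu].
split; first exact: Xbar_cone.
exact: det_observability.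
Qed.
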